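(* Let $X$ be a finite dimensional normed space, and let the set $A \subset X$ be closed. Suppose that: (1) $f$ is l.s.c. on $A$ and Lipschitz continuous near each globally optimal solution of the problem $(\mathcal{P})$; (2) $G$ is metrically subregular with respect to the set $A$ at $(x^*, 0)$ for every globally optimal solution $x^*$ of $(\mathcal{P})$; (3) the mapping $(x, p) \mapsto d(0, G(x) - p w)$ is l.s.c. on $A \times \mathbb{R}_+$; (4) the functions $\phi$ and $\omega$ are l.s.c., and there exist $\phi_0, \omega_0, t_0 > 0$ such that $\phi(t) \ge \phi_0 t$ and $\omega(t) \ge \omega_0 t$ for any $t \in (0, t_0)$; (5) either there exists $\delta > 0$ such that the set $\{ x \in A \mid d(0, G(x)) < \delta \}$ is bounded, or there exists $\mu \ge 0$ such that the set $\{ x \in A \mid f(x) + \mu\, d(0, G(x)) < f^* \}$ is bounded. Then the singular penalty function $F_{\lambda}$ is (globally) exact if and only if it is bounded below on $A \times \mathbb{R}_+$ for some $\lambda \ge 0$.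
   Context: Setting. $Y$ is a normed space, $A \subset X$ nonempty, $f \colon X \to \mathbb{R} \cup \{+\infty\}$, and $G \colon X \rightrightarrows Y$ a set-valued mapping with closed values. The problem $(\mathcal{P})$ is: minimize $f(x)$ subject to $0 \in G(x)$, $x \in A$; its feasible set is $\Omega = \{x \in A : 0 \in G(x)\}$. It is assumed that $f$ attains a global minimum on $\Omega$, with finite value $f^*$. $\mathbb{R}_+ = [0,+\infty)$. Singular penalty function. Fix $w \in Y$ and non-decreasing functions $\phi \colon [0, +\infty] \to [0, +\infty]$, $\omega \colon \mathbb{R}_+ \to [0, +\infty]$ such that $\phi(t) = 0$ iff $t = 0$ and $\omega(t) = 0$ iff $t = 0$. For $(x,p) \in X \times \mathbb{R}_+$ put $\varphi(x,p) = 0$ if $x \in \Omega$, $p = 0$; $\varphi(x,p) = +\infty$ if $x \notin \Omega$, $p = 0$; and $\varphi(x,p) = p^{-1} \phi( d(0, G(x) - p w)^2 ) + \omega(p)$ if $p > 0$, where $d(0, G(x) - pw) = \inf_{y \in G(x)} \|y - pw\|$ if $G(x) \neq \emptyset$, and $= +\infty$ if $G(x) = \emptyset$. The singular penalty function is $F_\lambda(x,p) = f(x) + \lambda \varphi(x,p)$, $\lambda \ge 0$. Global exactness: there exists $\lambda_0 \ge 0$ such that $F_{\lambda_0}$ attains a global minimum on $A \times \mathbb{R}_+$, and $(x^*, p^* )$ is a global minimizer of $F_{\lambda_0}$ on $A\times \mathbb{R}_+$ iff $p^* = 0$ and $x^*$ is a globally optimal solution of $(\mathcal{P})$. Metric subregularity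 of $G$ with respect to $A$ at $(x^*,0)$ (where $x^* \in A$, $0 \in G(x^* )$): there exist $\tau > 0$ and a neighbourhood $U$ of $x^*$ such that $d(0, G(x)) \ge \tau\, d(x, G^{-1}(0) \cap A)$ for all $x \in U \cap A$. ''L.s.c. on a set'' means lower semicontinuous at every point of that set. *)

(* Defs.v *)
From HB Require Import structures.
From mathcomp Require Import all_boot all_order all_algebra.
From mathcomp Require Import all_classical all_reals all_analysis.

Set Implicit Arguments.
Unset Strict Implicit.
Unset Printing Implicit Defensive.

Import Order.TTheory GRing.Theory Num.Theory.
Import numFieldNormedType.Exports.

Local Open Scope classical_set_scope.
Local Open Scope ring_scope.
Local Open Scope ereal_scope.

(* [inhabited] because [Vector.axiom] lives in [Type]. *)
Definition finite_dimensional (R : realType) (X : lmodType R) : Prop :=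
  exists n : nat, inhabited (Vector.axiom n X).

(* [f] is a total extension of a function whose actual domain is [D], so the
   neighbourhoods are taken relative to [D]. *)
Definition lsc_at (T : topologicalType) (R : realType) (D : set T)
    (f : T -> \bar R) (x : T) : Prop :=
  forall a : R, a%:E < f x -> \forall y \near within D (nbhs x), a%:E < f y.

Definition lsc_on (T : topologicalType) (R : realType) (D S : set T)
    (f : T -> \bar R) : Prop :=
  forall x, S x -> lsc_at D f x.

Definition lipschitz_near (R : realType) (X : normedModType R)
    (f : X -> \bar R) (x : X) : Prop :=
  exists2 U : set X, nbhs x U &
    (forall y, U y -> f y \is a fin_num) /\ [lipschitz fine (f y) | y in U].

Definition global_minimizer (T : Type) (R : realType) (D : set T)
    (F : T -> \bar R) (z : T) : Prop :=
  D z /\ forall y, D y -> F z <= F y.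

Definition bounded_below_on (T : Type) (R : realType) (D : set T)
    (F : T -> \bar R) : Prop :=
  exists m : R, forall z, D z -> m%:E <= F z.

(* Equal to [+oo] when [S] is empty. *)
Definition dist_set (R : realType) (V : normedModType R) (v : V) (S : set V) :
    \bar R :=
  ereal_inf [set (`|(s - v)%R|)%:E | s in S].

Lemma dist_setE (R : realType) (V : normedModType R) (v : V) (S : set V) :
  dist_set v S = edist_inf S v.
Proof.
rewrite /dist_set /edist_inf; congr (ereal_inf _).
apply: eq_imagel => s Ss; apply/eqP; rewrite eq_le; apply/andP; split.
  apply: le_ereal_inf_tmp => _ [r [_ +] <-].
  by rewrite -ball_normE /= distrC => /ltW; rewrite lee_fin.
apply/lee_addgt0Pr => e e0; apply: ereal_inf_lbound.
exists (`|s - v| + e)%R => //=; split; first by rewrite ltr_wpDl.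
by rewrite -ball_normE /= distrC ltrDl.
Qed.

Definition Rplus (R : realType) : set R := [set p | (0 <= p)%R].

Section singular_penalty.
Context {R : realType} {X Y : normedModType R}.
Variables (f : X -> \bar R) (A : set X) (G : X -> set Y).

Definition feasible : set X := [set x | A x /\ G x 0%R].

Definition optimal : set X := [set x | global_minimizer feasible f x].

Definition metrically_subregular (x : X) : Prop :=
  exists2 tau : R, (0 < tau)%R &
  exists2 U : set X, nbhs x U &
  forall y, (U `&` A) y ->
    tau%:E * dist_set y ([set z | G z 0%R] `&` A) <= dist_set 0%R (G y).

Variable w : Y.

Definition shifted_dist (z : X * R) : \bar R :=
  dist_set 0%R [set (y - z.2 *: w)%R | y in G z.1].

Variables (phi : \bar R -> \bar R) (omega : R -> \bar R).

(* Only the values at [0 <= z.2] are meaningful. *)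
Definition penalty_term (z : X * R) : \bar R :=
  if (0 < z.2)%R
  then (z.2^-1)%:E * phi (shifted_dist z ^+ 2) + omega z.2
  else if z.1 \in feasible then 0 else +oo.

(* As [0 * +oo = 0] here, [singular_penalty 0 z] is [f z.1]. *)
Definition singular_penalty (lambda : R) (z : X * R) : \bar R :=
  f z.1 + lambda%:E * penalty_term z.

Definition globally_exact : Prop :=
  exists2 lambda0 : R, (0 <= lambda0)%R &
    (exists z, global_minimizer (A `*` @Rplus R) (singular_penalty lambda0) z)
    /\ forall x p,
      global_minimizer (A `*` @Rplus R) (singular_penalty lambda0) (x, p) <->
      p = 0%R /\ optimal x.

End singular_penalty.

(* Main.v *)
(* Since [d^2 / p + p >= (d + p) / 2], the penalty term grows at least linearly
   in [d + p] near zero.  So wherever [F_L (x, p) <= f^*] with [p > 0] and [L]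
   large, both [p] and the residual [d = d(0, G x - p w)] are small, because [F]
   is bounded below for some parameter, and [f x + K (d + p) < f^*] for any
   prescribed [K].  Each point of [A] has a neighbourhood on which this is
   impossible for [L] large: lower semicontinuity of the distance deals with
   infeasible points and that of [f] with feasible nonoptimal ones; at an
   optimal point metric subregularity moves [x] to a feasible [y] with [|y - x|]
   linear in [d + p], and the Lipschitz bound contradicts [f y >= f^*].
   Hypothesis (5) confines the bad points to a compact set, so that a single
   [L] works. *)
From HB Require Import structures.
Require Import Defs.
From mathcomp Require Import all_boot all_order all_algebra.
From mathcomp Require Import all_classical all_reals all_analysis.
From mathcomp Require Import ring lra.
Import Order.TTheory GRing.Theory Num.Theory.
Import numFieldNormedType.Exports.
Local Open Scope classical_set_scope.
Local Open Scope ring_scope.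
Local Open Scope ereal_scope.

(** * Compactness in finite-dimensional normed spaces *)

Lemma linear_rV_continuous {R : realType} {X : normedModType R} {n : nat}
  (g : {linear 'rV[R]_n -> X}) : continuous g.
Proof.
(* Row vectors carry the maximum norm, so expanding in the standard basis makes [C] a bound for the
   operator norm of [g]. *)
pose C := (\sum_(i < n) `|g (delta_mx 0 i)|)%R.
apply: bounded_linear_continuous; apply/linear_boundedP.
exists C; split; first exact: num_real.
move=> D CD u /=; suff /le_trans : (`|g u| <= C * `|u|)%R.
  by apply; rewrite ler_wpM2r// ltW.
rewrite {1}(row_sum_delta u) linear_sum/= mulr_suml.
apply: le_trans (ler_norm_sum _ _ _) _; apply: ler_sum => i _.
rewrite linearZ/= normrZ mulrC ler_wpM2l//.
rewrite [leRHS]/Num.norm/= mx_normrE.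
exact: (le_bigmax _ (fun ij : 'I_1 * 'I_n => `|u ij.1 ij.2|%R) (ord0, i)).
Qed.

Lemma finite_dimensional_compact {R : realType} {X : normedModType R}
  (B : set X) :
  finite_dimensional X -> bounded_set B -> closed B -> compact B.
Proof.
move=> [n [[v vlin [g vK gK]]]] [M [_ BM]] Bcl.
pose vl : {linear X -> 'rV[R]_n} :=
  HB.pack v (GRing.isLinear.Build _ _ _ _ v vlin).
have glin : linear g by exact: (can2_linear (f := vl)).
pose gl : {linear 'rV[R]_n -> X} :=
  HB.pack g (GRing.isLinear.Build _ _ _ _ g glin).
have v0 : v 0%R = 0%R := linear0 vl.
have g0 : g 0%R = 0%R := linear0 gl.
have gZ a u : g (a *: u)%R = (a *: g u)%R by exact: (linearZ_LR gl).
have gc : continuous g by exact: (linear_rV_continuous gl).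
have gngc : continuous (fun u => `|g u|%R).
  by move=> u; apply: continuous_comp (gc u) _; exact: norm_continuous.
pose S : set 'rV[R]_n := [set u | `|u|%R = 1%R].
have Scpt : compact S.
  apply: bounded_closed_compact.
    by exists 1%R; split; [exact: num_real|move=> D D1 u /= ->; exact: ltW].
  have -> : S = (fun u => `|u|%R) @^-1` [set 1%R] by [].
  apply: preimage_closed; last exact: closed_eq.
  by move=> u _; exact: norm_continuous.
(* Near each [u] on the sphere the bound [|g u| / 2] works, and compactness makes it uniform. *)
have Snear : \forall d \near 0%R^'+, S `<=` (fun u => (d <= `|g u|)%R).
  move/compact_near_coveringP : Scpt; apply => u Su.
  have gu0 : (0 < `|g u|)%R.
    rewrite normr_gt0; apply/eqP => gu0.
    have : u = 0%R by rewrite -(gK u) gu0 v0.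
    move=> u0; move: Su; rewrite /S/= u0 normr0 => /esym/eqP.
    by rewrite oner_eq0.
  near=> u' d => /=.
  apply: (@le_trans _ _ (`|g u| / 2)%R).
    by near: d; apply: nbhs_right_le; rewrite divr_gt0.
  near: u'; apply: (cvgr_ge `|g u|%R); first exact: gngc.
  by rewrite ltr_pdivrMr// ltr_pMr// ltr1n.
have [d [d0 Hd]] := filter_ex (filterI (nbhs_right_gt (0%R : R)) Snear).
have vb x : (`|v x| <= d^-1 * `|x|)%R.
  have [->|x0] := eqVneq x 0%R; first by rewrite v0 !normr0 mulr0.
  have vx0 : (0 < `|v x|)%R.
    rewrite normr_gt0; apply: contra_neq x0 => vx0.
    by rewrite -(vK x) vx0 g0.
  have := Hd (`|v x|^-1 *: v x)%R; rewrite gZ/= vK normrZ.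
  rewrite ger0_norm ?invr_ge0//; rewrite ler_pdivlMl// ler_pdivlMl// mulrC.
  apply; rewrite /S/= normrZ ger0_norm ?invr_ge0// mulVf// gt_eqF//.
have -> : B = g @` (v @` B).
  rewrite image_comp (_ : g \o v = id) ?image_id//.
  by apply/funext => x /=; exact: vK.
apply: continuous_compact.
  by apply: continuous_subspaceT.
apply: bounded_closed_compact.
  exists (d^-1 * (M + 1))%R; split; first exact: num_real.
  move=> D DM _ /= [x Bx <-].
  apply: le_trans (vb x) _; apply: le_trans (ltW DM).
  by rewrite ler_wpM2l ?invr_ge0 ?(ltW d0)//; apply: BM => //; rewrite ltrDl.
(* Since [v] and [g] are mutually inverse, closedness of the image follows from continuity of
   [g]. *)
have -> : v @` B = g @^-1` B.
  apply/seteqP; split => [_ [x Bx <-]|u gu] /=; first by rewrite vK.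
  by exists (g u).
by apply: preimage_closed => // u _; exact: gc.
Unshelve. all: by end_near. Qed.

(** * Distances to sets and the shifted distance *)

Lemma dist_set_ge0 {R : realType} {V : normedModType R} (v : V) (S : set V) :
  0 <= dist_set v S.
Proof. by rewrite dist_setE edist_inf_ge0. Qed.

Lemma dist_set_lt {R : realType} {V : normedModType R} {v : V} {S : set V}
    {e : R} :
  dist_set v S < e%:E -> exists2 s, S s & (`|s - v| < e)%R.
Proof.
move=> /ereal_inf_lt[_ [s Ss <-]]; rewrite lte_fin => sve.
by exists s.
Qed.

Lemma dist_set_closed_eq0 {R : realType} {V : normedModType R} (v : V)
    (S : set V) :
  closed S -> dist_set v S = 0 -> S v.
Proof.
move=> Scl d0; apply: Scl => B /nbhs_ballP[e /= e0 eB].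
have [|s Ss sve] := @dist_set_lt _ _ v S e; first by rewrite d0 lte_fin.
exists s; split => //; apply: eB.
by rewrite -ball_normE /= distrC.
Qed.

Section shifted_dist_lemmas.
Context {R : realType} {X Y : normedModType R}.
Variables (G : X -> set Y) (w : Y).

Lemma shifted_dist0 (x : X) : shifted_dist G w (x, 0%R) = dist_set 0%R (G x).
Proof.
rewrite /shifted_dist /= (_ : (fun y => _) = id) ?image_id//.
by apply/funext => y; rewrite scale0r subr0.
Qed.

(** Triangle inequality for [y = (y - p w) + p w]. It turns the residual seen by the penalty into
    the unshifted distance of subregularity and of hypothesis (5). *)
Lemma dist_set_le_shifted (x : X) (p : R) : (0 <= p)%R ->
  dist_set 0%R (G x) <= shifted_dist G w (x, p) + (p * `|w|)%:E.
Proof.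
move=> p0; rewrite -leeBlDr//; apply: le_ereal_inf_tmp.
move=> _ [_ [y Gy <-] <-]; rewrite leeBlDr//.
apply: (@le_trans _ _ (`|y - 0|%:E)%R).
  by apply: ereal_inf_lbound; exists y.
rewrite !subr0 -EFinD lee_fin -[X in (_ <= _ + X * _)%R](ger0_norm p0) -normrZ.
by rewrite -{1}(subrK (p *: w)%R y) ler_normD.
Qed.

End shifted_dist_lemmas.

(** * Growth and finiteness of the penalty *)

Lemma ereal_gt0_fin {R : realFieldType} {t : \bar R} :
  0 < t -> exists2 r : R, (0 < r)%R & r%:E < t.
Proof.
case: t => [r||//]; rewrite ?lte_fin => r0; last by exists 1%R; rewrite ?ltry.
by exists (r / 2)%R; rewrite ?lte_fin; lra.
Qed.

(** Here [c] is a common growth rate of [phi] and [omega]. The inequality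
    [(d + p) / 2 <= (d ^+ 2 + p ^+ 2) / p] follows from [2 d p <= d ^+ 2 + p ^+ 2], and strictness
    from [0 < d + p]. *)
Lemma penalty_growth {R : realFieldType} {c K L d p : R} :
  (0 < p)%R -> (0 <= d)%R -> (0 <= c)%R -> (0 <= L)%R -> (2 * K < L * c)%R ->
  (K * (d + p) < L * (p^-1 * (c * d ^+ 2) + c * p))%R.
Proof.
move=> p0 d0 c0 L0 KLc.
have -> : (L * (p^-1 * (c * d ^+ 2) + c * p) =
   (L * c) * ((d ^+ 2 + p ^+ 2) / p))%R.
  by field; rewrite gt_eqF.
have h : ((d + p) / 2 <= (d ^+ 2 + p ^+ 2) / p)%R.
  by rewrite ler_pdivlMr//; nra.
apply: (@lt_le_trans _ _ ((L * c) * ((d + p) / 2)))%R; first by nra.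
by rewrite ler_wpM2l// mulr_ge0.
Qed.

Section penalty_lemmas.
Context {R : realType} {X Y : normedModType R}.
Variables (f : X -> \bar R) (A : set X) (G : X -> set Y) (w : Y).
Variables (phi : \bar R -> \bar R) (omega : R -> \bar R).
Hypothesis f_proper : forall x, f x != -oo.
Hypothesis phi_ge0 : forall t, 0 <= t -> 0 <= phi t.
Hypothesis phi_ndecr : forall s t, 0 <= s -> s <= t -> phi s <= phi t.
Hypothesis phi_eq0 : forall t, 0 <= t -> (phi t = 0 <-> t = 0).
Hypothesis omega_ge0 : forall t, (0 <= t)%R -> 0 <= omega t.
Hypothesis omega_ndecr :
  forall s t, (0 <= s)%R -> (s <= t)%R -> omega s <= omega t.
Hypothesis omega_eq0 : forall t, (0 <= t)%R -> (omega t = 0 <-> t = 0%R).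

Let F := singular_penalty f A G w phi omega.

Lemma shifted_dist_ge0 z : 0 <= shifted_dist G w z.
Proof. exact: dist_set_ge0. Qed.

Lemma penalty_term_ge0 z : 0 <= penalty_term A G w phi omega z.
Proof.
rewrite /penalty_term; case: ifPn => [z0|_]; last by case: ifP.
apply: adde_ge0; last exact/omega_ge0/ltW.
by rewrite mule_ge0 ?lee_fin ?invr_ge0 ?(ltW z0)// phi_ge0// sqre_ge0.
Qed.

Lemma le_singular_penalty L z : (0 <= L)%R -> f z.1 <= F L z.
Proof.
by move=> L0; rewrite leeDl// mule_ge0 ?lee_fin// penalty_term_ge0.
Qed.

Lemma singular_penalty_feasible L x : feasible A G x -> F L (x, 0%R) = f x.
Proof.
move=> xO; rewrite /F /singular_penalty /penalty_term /= ltxx.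
by rewrite mem_set// mule0 adde0.
Qed.

Lemma singular_penalty_infeasible L x : (0 < L)%R -> ~ feasible A G x ->
  F L (x, 0%R) = +oo.
Proof.
move=> L0 xO; rewrite /F /singular_penalty /penalty_term /= ltxx.
by rewrite memNset// mulry gtr0_sg// mul1e addey.
Qed.

(** As [f] is never [-oo] and the penalty is nonnegative, an infinite summand would make the total
    [+oo]. The last clause keeps [r], [a], [b] for every parameter, so that values for two
    parameters can be compared. *)
Lemma singular_penalty_fin {L x p M} : (0 < L)%R -> (0 < p)%R ->
  F L (x, p) <= M%:E ->
  exists r a b : R, [/\ f x = r%:E,
    phi (shifted_dist G w (x, p) ^+ 2) = a%:E /\ omega p = b%:E,
    (0 <= a)%R /\ (0 <= b)%R, (r + L * (p^-1 * a + b) <= M)%R &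
    forall L', F L' (x, p) = (r + L' * (p^-1 * a + b))%:E].
Proof.
move=> L0 p0; set z := (x, p).
have T0 := penalty_term_ge0 z.
have LT0 : 0 <= L%:E * penalty_term A G w phi omega z.
  by rewrite mule_ge0// lee_fin ltW.
rewrite /F /singular_penalty /=.
have phi0 := @phi_ge0 (shifted_dist G w z ^+ 2) (sqre_ge0 _).
have omega0 := omega_ge0 p (ltW p0).
move: (f_proper x); case: (f x) => [r _| |//]; last first.
  by rewrite addye ?leye_eq// gt_eqF// (lt_le_trans ltNy0 LT0).
move: T0 {LT0}; rewrite /penalty_term /= p0.
case: (phi _) phi0 => [a a0| _|//]; last first.
  have omegaNy : omega p != -oo by rewrite gt_eqF// (lt_le_trans ltNy0 omega0).
  rewrite mulry gtr0_sg ?invr_gt0// mul1e addye//.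
  by rewrite mulry gtr0_sg// mul1e leye_eq.
case: (omega p) omega0 => [b b0| _|//] _; last first.
  by rewrite addey// mulry gtr0_sg// mul1e leye_eq.
rewrite -EFinM -EFinD -EFinM -EFinD lee_fin => h.
by exists r, a, b; split => // L'; rewrite -EFinM -EFinD.
Qed.

(** * Exactness near a point for large parameters *)

Section local_exactness.
Variables (fstar lambda1 : R).
Hypothesis growth : exists phi0 omega0 t0 : R,
    [/\ (0 < phi0)%R, (0 < omega0)%R, (0 < t0)%R &
      forall t : R, (0 < t < t0)%R ->
        (phi0 * t)%:E <= phi t%:E /\ (omega0 * t)%:E <= omega t].
Hypothesis F_bounded : bounded_below_on (A `*` @Rplus R) (F lambda1).

(** How large [L] must be depends on [K] and [eps] but not on [(x, p)]. The lower bound at [lambda1]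
    makes the penalty term small, monotonicity then makes [p] and [d] small, and linear growth near
    zero gives the last inequality. *)
Lemma near_penalty_residual K {eps} : (0 < eps)%R ->
  \forall L \near +oo%R, forall x p, A x -> (0 < p)%R ->
    F L (x, p) <= fstar%:E ->
    exists r d : R, [/\ f x = r%:E, shifted_dist G w (x, p) = d%:E,
      (0 <= d < eps)%R, (p < eps)%R & (r + K * (d + p) < fstar)%R].
Proof.
have [phi0 [omega0 [t0 [phi00 omega00 t00 growth_le]]]] := growth.
have [m mF] := F_bounded; move=> eps0.
(* With [e < t0] and [e <= 1], both [p < e] and [d < e] put [p] and [d ^+ 2] in the range of the
   growth condition. *)
pose e := Num.min eps (Num.min t0 1 / 2)%R.
have e0 : (0 < e)%R by rewrite lt_min eps0 divr_gt0// lt_min t00 ltr01.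
have [eeps et0 e1] : [/\ e <= eps, e < t0 & e <= 1]%R.
  have h : (e <= Num.min t0 1 / 2)%R by rewrite ge_min lexx orbT.
  have h1 : (Num.min t0 1 <= 1)%R by rewrite ge_min lexx orbT.
  have h2 : (Num.min t0 1 <= t0)%R by rewrite ge_min lexx.
  by split; [rewrite ge_min lexx|lra|lra].
have phie : 0 < phi (e%:E ^+ 2).
  have e20 : 0 < e%:E ^+ 2 by apply: expe_gt0.
  rewrite lt_neqAle phi_ge0 ?ltW// andbT eq_sym; apply/eqP.
  by move/(phi_eq0 _ (ltW e20)) => h; rewrite h ltxx in e20.
have omegae : 0 < omega e.
  rewrite lt_neqAle omega_ge0 ?ltW// andbT eq_sym; apply/eqP.
  by move/(omega_eq0 _ (ltW e0)) => h; rewrite h ltxx in e0.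
(* By monotonicity, values of [phi (d ^+ 2)] and [omega p] not exceeding [eta] force [d < e] and
   [p < e]. *)
have [eta [eta0 etaphi etaomega]] :
    exists eta : R,
      [/\ (0 < eta)%R, eta%:E < phi (e%:E ^+ 2) & eta%:E < omega e].
  have [|eta eta0] := @ereal_gt0_fin _ (Order.min (phi (e%:E ^+ 2)) (omega e)).
    by rewrite lt_min phie.
  by rewrite lt_min => /andP[]; exists eta.
pose c := Num.min phi0 omega0.
have c0 : (0 < c)%R by rewrite lt_min phi00.
have [cphi comega] : (c <= phi0)%R /\ (c <= omega0)%R.
  by rewrite !ge_min !lexx orbT.
near=> L => x p Ax p0 FL.
have L0 : (0 < L)%R by near: L; exact: (nbhs_pinfty_gt (num_real _)).
have [r [a [b [fr [phia omegab] [a0 b0] rLf Frb]]]] :=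
  singular_penalty_fin L0 p0 FL.
have : m%:E <= F lambda1 (x, p) by apply: mF; split => //=; exact: ltW.
rewrite Frb lee_fin => mr.
pose T := (p^-1 * a + b)%R; rewrite -/T in rLf mr.
have pa0 : (0 <= p^-1 * a)%R by rewrite mulr_ge0 ?invr_ge0 ?(ltW p0).
(* Subtracting [m <= r + lambda1 * T] from [r + L * T <= fstar] bounds [(L - lambda1) * T] by
   [fstar - m]. *)
have Teta : (T < eta)%R.
  rewrite ltNge; apply/negP => etaT.
  have h : ((fstar - m) / eta < L - lambda1)%R.
    by rewrite ltrBrDr; near: L; exact: (nbhs_pinfty_gt (num_real _)).
  rewrite ltr_pdivrMr// in h.
  have h1 : (0 < L - lambda1)%R.
    by rewrite subr_gt0; near: L; exact: (nbhs_pinfty_gt (num_real _)).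
  have : ((L - lambda1) * eta <= (L - lambda1) * T)%R.
    by rewrite ler_wpM2l// ltW.
  lra.
have pe : (p < e)%R.
  rewrite ltNge; apply/negP => /(omega_ndecr _ _ (ltW e0)); apply/negP.
  rewrite -ltNge omegab (le_lt_trans _ etaomega)// lee_fin.
  by rewrite (le_trans _ (ltW Teta))// lerDr.
(* Since [p <= 1], dividing by [p] does not decrease [a]. *)
have aeta : (a <= eta)%R.
  have : (p^-1 * a <= eta)%R by rewrite (le_trans _ (ltW Teta))// lerDl.
  rewrite ler_pdivrMl// => /le_trans; apply.
  by rewrite ler_piMl// ?(ltW eta0)// (le_trans (ltW pe)).
have : shifted_dist G w (x, p) < e%:E.
  apply: lte_sqrE; first by rewrite lee_fin ltW.
  rewrite ltNge; apply/negP => /(phi_ndecr _ _ (sqre_ge0 _)); apply/negP.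
  by rewrite -ltNge phia (le_lt_trans _ etaphi)// lee_fin.
have := shifted_dist_ge0 (x, p).
case: (shifted_dist G w (x, p)) phia => [d||]// phia.
rewrite lee_fin lte_fin => d0 de.
exists r, d; split => //.
- by rewrite d0 (lt_le_trans de).
- exact: lt_le_trans eeps.
have pb : (c * p <= b)%R.
  have [] := growth_le p; first by rewrite p0 (lt_trans pe).
  by rewrite omegab !lee_fin => _; apply: le_trans; rewrite ler_wpM2r// ltW.
have da : (c * d ^+ 2 <= a)%R.
  have [->|dn0] := eqVneq d 0%R; first by rewrite expr0n/= mulr0.
  have d20 : (0 < d ^+ 2)%R by rewrite exprn_even_gt0.
  have [] := growth_le (d ^+ 2)%R.
    by rewrite d20/= expr2; nra.
  rewrite EFin_expe phia lee_fin => + _; apply: le_trans.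
  by rewrite ler_wpM2r// ltW.
have KL : (2 * K < L * c)%R.
  by rewrite -ltr_pdivrMr//; near: L; exact: (nbhs_pinfty_gt (num_real _)).
apply: lt_le_trans rLf; rewrite ltrD2l.
apply: lt_le_trans (penalty_growth p0 d0 (ltW c0) (ltW L0) KL) _.
by rewrite ler_wpM2l ?(ltW L0)// lerD// ler_wpM2l// invr_ge0 ltW.
Unshelve. all: by end_near. Qed.

(** The slope [k * W / tau] is chosen so that [f y <= f x + k * |x - y|], with
    [|x - y| < (d + p * W) / tau], yields [f y < fstar] at a feasible [y]. *)
Lemma near_exact_optimal x0 : optimal f A G x0 -> f x0 = fstar%:E ->
  lipschitz_near f x0 -> metrically_subregular A G x0 ->
  \forall x \near x0 & L \near +oo%R, A x ->
    forall p, (0 < p)%R -> fstar%:E < F L (x, p).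
Proof.
move=> [x0O x0min] fx0 [U Ux0 [Ufin [k0 [_ Ulip]]]] [tau tau0 [V Vx0 Vsub]].
have /nbhs_ballP[s /= s0 sU] := Ux0.
pose k := (`|k0| + 1)%R.
have k_gt0 : (0 < k)%R by rewrite ltr_wpDl.
have kk : (k0 < k)%R by rewrite (le_lt_trans (ler_norm k0))// ltrDl.
have klip := Ulip k kk.
(* Exceeding [|w|] strictly provides the slack to pick [y] although the infimum may not be attained;
   [1 <= W] absorbs [d] into [W * d]. *)
pose W := (`|w| + 1)%R.
have W1 : (1 <= W)%R by rewrite lerDr.
have W0 : (0 < W)%R by exact: lt_le_trans W1.
(* From [d, p < q] follows [e < 2 * q * W / tau = s / 2], so [x] and [y] both stay in the ball of
   radius [s] about [x0]. *)
pose q := (s * tau / (4 * W))%R.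
have qW : (q * W = s * tau / 4)%R by rewrite /q; field; rewrite gt_eqF.
have q0 : (0 < q)%R by rewrite divr_gt0 ?mulr_gt0.
have res := near_penalty_residual (k * W / tau)%R q0.
near=> x L => Ax p p0; rewrite ltNge; apply/negP => FL.
have resL : forall x p, A x -> (0 < p)%R -> F L (x, p) <= fstar%:E ->
    exists r d : R, [/\ f x = r%:E, shifted_dist G w (x, p) = d%:E,
      (0 <= d < q)%R, (p < q)%R &
      (r + k * W / tau * (d + p) < fstar)%R].
  by near: L; exact: res.
have [r [d [fr sd /andP[d0 deps] peps rlt]]] := resL x p Ax p0 FL.
have xs : (`|x0 - x| < s / 2)%R.
  by near: x; apply: (@cvgr_dist_lt _ _ _ _ _ id); [exact: cvg_id|lra].
have Vx : V x by near: x.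
pose e := ((d + p * W) / tau)%R.
have e_lt : (e < s / 2)%R.
  rewrite /e ltr_pdivrMr//.
  have pW : (p * W < q * W)%R by rewrite ltr_pM2r.
  have : (q <= q * W)%R by rewrite ler_peMr// ltW.
  lra.
have [y [Gy Ay] yxe] :
    exists2 y, ([set z | G z 0%R] `&` A) y & (`|y - x| < e)%R.
  apply: dist_set_lt.
  rewrite -(@lte_pmul2l _ tau%:E)// -EFinM /e.
  apply: le_lt_trans (Vsub _ (conj Vx Ax)) _.
  apply: le_lt_trans (dist_set_le_shifted _ w x p (ltW p0)) _.
  rewrite sd -EFinD lte_fin mulrCA divff ?gt_eqF// mulr1.
  by rewrite ltrD2l ltr_pM2l// ltrDl.
have Ux : U x by apply: sU; rewrite -ball_normE /=; lra.
have Uy : U y.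
  apply: sU; rewrite -ball_normE /= -(subrK x x0) -addrA.
  by rewrite (le_lt_trans (ler_normD _ _))// (distrC x); lra.
have fy : fstar%:E <= f y by rewrite -fx0; exact: x0min.
have := klip (x, y) (conj Ux Uy); rewrite /= fr.
have := Ufin y Uy; case: (f y) fy => [t| |]//; rewrite lee_fin /= => ft _.
rewrite ler_norml => /andP[+ _].
have h1 : (k * `|x - y| <= k * e)%R by rewrite ler_wpM2l ?ltW// distrC.
have h2 : (k * e <= k * W / tau * (d + p))%R.
  have -> : (k * W / tau * (d + p) = k * ((W * d + p * W) / tau))%R by ring.
  rewrite ler_wpM2l ?(ltW k_gt0)// ler_wpM2r ?invr_ge0 ?(ltW tau0)//.
  by rewrite lerD2r ler_peMl.
lra.
Unshelve. all: by end_near. Qed.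

Lemma near_exact_nonoptimal x0 : fstar%:E < f x0 ->
  lsc_at setT f x0 ->
  \forall x \near x0 & L \near +oo%R, A x ->
    forall p, (0 < p)%R -> fstar%:E < F L (x, p).
Proof.
move=> fx0 /(_ _ fx0); rewrite near_withinE => flsc.
near=> x L => _ p p0; apply: (@lt_le_trans _ _ (f x)).
  by near: x; apply: filterS flsc => y; apply.
by apply: (le_singular_penalty L (x, p)).
Unshelve. all: by end_near. Qed.

(** Joint lower semicontinuity at [(x0, 0)] keeps the residual above [a] for [x] near [x0] and
    [0 <= p < e], while for large [L] a bad point has residual below [a] and [p < e]. *)
Lemma near_exact_infeasible x0 : 0 < dist_set 0%R (G x0) ->
  lsc_at (setT `*` @Rplus R) (shifted_dist G w) (x0, 0%R) ->
  \forall x \near x0 & L \near +oo%R, A x ->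
    forall p, (0 < p)%R -> fstar%:E < F L (x, p).
Proof.
move=> /ereal_gt0_fin[a a0 adist] /(_ a); rewrite shifted_dist0.
move=> /(_ adist) [[B C] /= [Bx0 /nbhs_ballP[e /= e0 eC]] BC].
have eps0 : (0 < Num.min a e)%R by rewrite lt_min a0.
have res := near_penalty_residual 0%R eps0.
near=> x L => Ax p p0; rewrite ltNge; apply/negP => FL.
have resL : forall x p, A x -> (0 < p)%R -> F L (x, p) <= fstar%:E ->
    exists r d : R, [/\ f x = r%:E, shifted_dist G w (x, p) = d%:E,
      (0 <= d < Num.min a e)%R, (p < Num.min a e)%R &
      (r + 0 * (d + p) < fstar)%R].
  by near: L; exact: res.
have [r [d [_ sd /andP[d0]]]] := resL x p Ax p0 FL.
rewrite !lt_min => /andP[da _] /andP[_ pe] _.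
have Bx : B x by near: x.
have : a%:E < shifted_dist G w (x, p).
  apply: BC; last by split => //=; exact: ltW.
  split => //=; apply: eC.
  by rewrite -ball_normE /= sub0r normrN gtr0_norm.
by rewrite sd lte_fin ltNge ltW.
Unshelve. all: by end_near. Qed.

(** For large [L] the bad points lie in whichever set hypothesis (5) declares bounded. *)
Lemma near_residual_bounded :
  (exists2 delta : R, (0 < delta)%R &
     bounded_set [set x | A x /\ dist_set 0%R (G x) < delta%:E]) \/
  (exists2 mu : R, (0 <= mu)%R &
     bounded_set
       [set x | A x /\ f x + mu%:E * dist_set 0%R (G x) < fstar%:E]) ->
  exists M : R, \forall L \near +oo%R, forall x p, A x -> (0 < p)%R ->
    F L (x, p) <= fstar%:E -> (`|x| <= M)%R.
Proof.
case=> [[delta delta0]|[mu mu0]] [M [_ HM]]; exists (M + 1)%R.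
  (* This radius gives [d + p * |w| < delta]. *)
  have eps0 : (0 < delta / (`|w| + 1))%R by rewrite divr_gt0 ?ltr_wpDl.
  apply: filterS (near_penalty_residual 0%R eps0) => L res x p Ax p0 FL.
  have [r [d [_ sd /andP[d0 dd] pd _]]] := res x p Ax p0 FL.
  apply: (HM (M + 1)%R); first by rewrite ltrDl.
  split => //; apply: le_lt_trans (dist_set_le_shifted _ w x p (ltW p0)) _.
  rewrite sd -EFinD lte_fin.
  have W0 : (0 < `|w| + 1)%R by rewrite ltr_wpDl.
  have := divfK (lt0r_neq0 W0) delta; have := ler_wpM2r (normr_ge0 w) (ltW pd).
  lra.
(* The slope dominates: [mu * (d + p * |w|) <= mu * (|w| + 1) * (d + p)]. *)
apply: filterS (near_penalty_residual (mu * (`|w| + 1))%R ltr01).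
move=> L res x p Ax p0 FL.
have [r [d [fr sd /andP[d0 dd] pd rlt]]] := res x p Ax p0 FL.
apply: (HM (M + 1)%R); first by rewrite ltrDl.
split => //; rewrite fr.
apply: le_lt_trans (_ : (r + mu * (d + p * `|w|))%:E < _).
  rewrite EFinD leeD2l// EFinM lee_wpmul2l ?lee_fin//.
  apply: le_trans (dist_set_le_shifted _ w x p (ltW p0)) _.
  by rewrite sd -EFinD.
rewrite lte_fin.
apply: le_lt_trans rlt; rewrite lerD2l -mulrA ler_wpM2l//.
have := mulr_ge0 (normr_ge0 w) d0; lra.
Qed.

End local_exactness.

End penalty_lemmas.

(** * From local to global exactness by compactness *)

Theorem theorem4p6 (R : realType) (X Y : normedModType R)
  (A : set X) (f : X -> \bar R) (G : X -> set Y) (fstar : R)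
  (w : Y) (phi : \bar R -> \bar R) (omega : R -> \bar R)
  (A_nonempty : A !=set0)
  (f_proper : forall x, f x != -oo)
  (G_closed : forall x, closed (G x))
  (f_min : exists2 x, optimal f A G x & f x = fstar%:E)
  (phi_ge0 : forall t, 0 <= t -> 0 <= phi t)
  (phi_ndecr : forall s t, 0 <= s -> s <= t -> phi s <= phi t)
  (phi_eq0 : forall t, 0 <= t -> (phi t = 0 <-> t = 0))
  (omega_ge0 : forall t, (0 <= t)%R -> 0 <= omega t)
  (omega_ndecr : forall s t, (0 <= s)%R -> (s <= t)%R -> omega s <= omega t)
  (omega_eq0 : forall t, (0 <= t)%R -> (omega t = 0 <-> t = 0%R))
  (X_findim : finite_dimensional X)
  (A_closed : closed A)
  (f_lsc : lsc_on setT A f)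
  (f_lipschitz : forall x, optimal f A G x -> lipschitz_near f x)
  (G_subregular : forall x, optimal f A G x -> metrically_subregular A G x)
  (dist_lsc : lsc_on (setT `*` @Rplus R) (A `*` @Rplus R) (shifted_dist G w))
  (phi_lsc : lsc_on [set t | 0 <= t] [set t | 0 <= t] phi)
  (omega_lsc : lsc_on (@Rplus R) (@Rplus R) omega)
  (growth : exists phi0 omega0 t0 : R,
    [/\ (0 < phi0)%R, (0 < omega0)%R, (0 < t0)%R &
      forall t : R, (0 < t < t0)%R ->
        (phi0 * t)%:E <= phi t%:E /\ (omega0 * t)%:E <= omega t])
  (bounded_sublevel :
    (exists2 delta : R, (0 < delta)%R &
       bounded_set [set x | A x /\ dist_set 0%R (G x) < delta%:E]) \/
    (exists2 mu : R, (0 <= mu)%R &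
       bounded_set
         [set x | A x /\ f x + mu%:E * dist_set 0%R (G x) < fstar%:E])) :
  globally_exact f A G w phi omega <->
  exists2 lambda : R, (0 <= lambda)%R &
    bounded_below_on (A `*` @Rplus R)
      (singular_penalty f A G w phi omega lambda).
Proof.
have [x0 x0opt fx0] := f_min.
have optE x : optimal f A G x -> f x = fstar%:E.
  move=> [xO xmin]; rewrite -fx0; apply/le_anti/andP; split.
    by apply: xmin; case: x0opt.
  by case: x0opt => _; exact.
split=> [[lambda lambda0 [[[x p] xpmin] minP]]|[lambda1 _ bdd]].
  (* Exactness places the minimizer at [p = 0] and an optimal [x], where the penalty function equals
     [fstar]. *)
  exists lambda => //; exists fstar => z zA.
  have [p0 xopt] := (minP x p).1 xpmin; case: xpmin => _ /(_ z zA).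
  by rewrite p0 singular_penalty_feasible ?optE//; case: xopt.
pose F := singular_penalty f A G w phi omega.
have [M HM] := near_residual_bounded f A G w phi omega f_proper phi_ge0
  phi_ndecr phi_eq0 omega_ge0 omega_ndecr omega_eq0 fstar lambda1 growth bdd
  bounded_sublevel.
pose K := A `&` [set x | (`|x| <= M)%R].
have Kcpt : compact K.
  apply: finite_dimensional_compact => //.
    exists M; split; first exact: num_real.
    by move=> D MD x [_ /= /le_trans]; apply; exact: ltW.
  apply: closedI => //.
  apply: (@preimage_closed _ _ (fun x : X => `|x|%R) [set r | (r <= M)%R]).
    by move=> x _; exact: norm_continuous.
  exact: closed_le.
have exactK : \forall L \near +oo%R, K `<=`
    (fun x => A x -> forall p, (0 < p)%R -> fstar%:E < F L (x, p)).
  move/compact_near_coveringP : Kcpt; apply => x [Ax _].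
  have [xO|xO] := pselect (feasible A G x).
    have [xopt|xnopt] := pselect (optimal f A G x).
      apply: (near_exact_optimal f A G w phi omega f_proper phi_ge0
        phi_ndecr phi_eq0 omega_ge0 omega_ndecr omega_eq0 fstar lambda1) => //.
      - exact: optE.
      - exact: f_lipschitz.
      - exact: G_subregular.
    apply: near_exact_nonoptimal => //; last exact: f_lsc.
    rewrite ltNge; apply/negP => fx; apply: xnopt; split => // y yO.
    by apply: le_trans fx _; rewrite -fx0; case: x0opt => _; exact.
  apply: (near_exact_infeasible f A G w phi omega f_proper phi_ge0
        phi_ndecr phi_eq0 omega_ge0 omega_ndecr omega_eq0 fstar lambda1) => //.
    (* A zero distance to the closed set [G x] would make [x] feasible. *)
    rewrite lt_neqAle dist_set_ge0 andbT eq_sym; apply/eqP => d0; apply: xO.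
    by split => //; exact: dist_set_closed_eq0.
  by apply: dist_lsc; split => //=; exact: lexx.
(* One [L] confines the bad points to [K] and excludes them there. Positivity of [L] makes [F L]
   infinite at infeasible points with [p = 0], as [0 * +oo = 0]. *)
have [L [[L0 LM] LK]] :=
  filter_ex (filterI (filterI (nbhs_pinfty_gt (num_real (0%R : R))) HM) exactK).
have gtF x p : A x -> (0 < p)%R -> fstar%:E < F L (x, p).
  move=> Ax p0; rewrite ltNge; apply/negP => FL.
  by have := LK x (conj Ax (LM x p Ax p0 FL)) Ax p p0; rewrite ltNge FL.
have geF z : (A `*` @Rplus R) z -> fstar%:E <= F L z.
  case: z => x p [/= Ax]; rewrite /Rplus/= le_eqVlt.
  move=> /orP[/eqP <-|p0]; last exact/ltW/gtF.
  have [xO|xO] := pselect (feasible A G x).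
    by rewrite /F singular_penalty_feasible// -fx0; case: x0opt => _; exact.
  by rewrite /F singular_penalty_infeasible// leey.
have optmin x : optimal f A G x ->
    global_minimizer (A `*` @Rplus R) (F L) (x, 0%R).
  move=> xopt; have [xO _] := xopt; split.
    by split; [exact: xO.1|exact: lexx].
  by rewrite {1}/F singular_penalty_feasible// optE.
exists L; first exact: ltW.
split; first by exists (x0, 0%R); exact: optmin.
move=> x p; split=> [[[/= Ax p0] xpmin]|[-> xopt]]; last exact: optmin.
(* Comparison with [(x0, 0)] rules out both [p > 0] and infeasible [x]. *)
have FxpM : F L (x, p) <= fstar%:E.
  rewrite -fx0 -(singular_penalty_feasible f A G w phi omega L x0); last first.
    by case: x0opt.
  by apply: xpmin; split; [exact: x0opt.1.1|exact: lexx].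
have p_eq0 : p = 0%R.
  apply/eqP; rewrite eq_le p0 andbT leNgt; apply/negP => /(gtF x p Ax).
  by rewrite ltNge FxpM.
split=> //; rewrite {}p_eq0 in FxpM.
have [xO|xO] := pselect (feasible A G x); last first.
  by move: FxpM; rewrite /F singular_penalty_infeasible// leye_eq.
split=> // y yO; move: FxpM; rewrite /F singular_penalty_feasible//.
move=> /le_trans; apply; rewrite -fx0; case: x0opt => _; exact.
Qed.
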